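(* Let $N,M,T\ge 1$ be integers, $D>0$, $V_T\ge 0$, and let $\alpha\ge 0$ be a constant for which the Whittle-closeness assumption (see context) holds for $N$, $M$, $D$. Let $\mathcal{C}(V_T)$ be the set of sequences of epoch costs $C_1,\dots,C_T$ (arising from nondecreasing AoI cost functions $f_k^{(i)}:\{1,\dots,M\}\to[0,D]$) such that $$\sum_{k=2}^{T}\max_{\pi\in\Pi}\big|C_{k-1}(\pi)-C_k(\pi)\big|\le V_T .$$ Let $\pi_1,\dots,\pi_T$ be the policies chosen by Follow the Dynamic Whittle Leader (FDWL), i.e. $\pi_k=\mathrm{Whittle}\big(f_{k-1}^{(1)},\dots,f_{k-1}^{(N)}\big)$ for $k=1,\dots,T$, where $f_0^{(i)}(j)=j$ for all $i\in\{1,\dots,N\}$, $j\in\{1,\dots,M\}$. Then the dynamic regret of FDWL satisfies $$\sup_{(C_1,\dots,C_T)\in\mathcal{C}(V_T)}\Big\{\sum_{k=1}^{T}C_k(\pi_k)-\sum_{k=1}^{T}\min_{\pi\in\Pi}C_k(\pi)\Big\}\;\le\;\alpha T+V_T+D .$$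
   Context: Setting. There are $N$ sources and time is divided into $T$ epochs of $M$ time-slots. A scheduling policy is a map $\pi$ from vectors of ages (positive integers) $(A^{(1)},\dots,A^{(N)})$ to $\{1,\dots,N\}$; $\Pi$ is the set of all such policies. Within each epoch, the ages of information (AoI) start at $A^{(i)}(1)=1$ for all $i$; for $1\le j\le M-1$, if $i=\pi(A^{(1)}(j),\dots,A^{(N)}(j))$ then $A^{(i)}(j+1)=1$, and otherwise $A^{(i)}(j+1)=A^{(i)}(j)+1$. At the end of slot $M$ all sources transmit, so all ages are reset to $1$ for the next epoch (the decision in slot $M$ has no effect on costs; in slots $j\le M-1$ all ages are at most $M-1$). Costs. For nondecreasing functions $g=(g^{(1)},\dots,g^{(N)})$ on $\{1,\dots,M\}$, put $C_g(\pi)=\frac{1}{NM}\sum_{j=1}^{M}\sum_{i=1}^{N}g^{(i)}(A^{(i)}(j))$, the ages evolving under $\pi$ over one epoch. In epoch $k$ an adversary chooses nondecreasing $f_k^{(i)}:\{1,\dots,M\}\to[0,D]$, and $C_k(\pi)=C_{f_k}(\pi)$. Full feedback: $f_k^{(1)},\dots,f_k^{(N)}$ are fully revealed at the end of epoch $k$. Whittle policy. For nondecreasing $f=(f^{(1)},\dots,f^{(N)})$, $\mathrm{Whittle}(f)\in\Pi$ is the policy that at ages $(A^{(1)},\dots,A^{(N)})$ schedules a source in $\arg\max_i W^{(i)}(A^{(i)})$ (with a fixed tie-breaking order on the sources), where $W^{(i)}(x)=x f^{(i)}(x+1)-\sum_{m=1}^{x}f^{(i)}(m)$. $\mathrm{Opt}(f)$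 denotes a (fixed choice of) policy minimizing $C_f(\pi)$ over $\pi\in\Pi$. Whittle-closeness assumption (with constant $\alpha$, which may depend on $N,M,D$). For any two families $f=(f^{(1)},\dots,f^{(N)})$ and $g=(g^{(1)},\dots,g^{(N)})$ of nondecreasing functions $\{1,\dots,M\}\to[0,D]$, $$\big|C_g(\mathrm{Whittle}(f))-C_g(\mathrm{Opt}(f))\big|\le\alpha .$$ *)

(* Defs.v *)
From HB Require Import structures.
From mathcomp Require Import all_boot all_order all_algebra.
From mathcomp Require Import all_classical all_reals.

Set Implicit Arguments.
Unset Strict Implicit.
Unset Printing Implicit Defensive.

Import Order.TTheory GRing.Theory Num.Theory.

Local Open Scope classical_set_scope.
Local Open Scope ring_scope.

Definition age : Type := {a : nat | (0 < a)%N}.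
Definition age1 : age := exist _ 1%N isT.
Definition ageS (a : age) : age := exist _ (sval a).+1 isT.

Definition policy (N : nat) : Type := ('I_N -> age) -> 'I_N.

Definition aoi_step (N : nat) (pi : policy N) (A : 'I_N -> age) : 'I_N -> age :=
  fun i => if i == pi A then age1 else ageS (A i).

(* Ages in slot j of an epoch; slots are numbered from 1. *)
Definition aoi (N : nat) (pi : policy N) (j : nat) : 'I_N -> age :=
  iter j.-1 (aoi_step pi) (fun=> age1).

(* A function on the ages {1, ..., M} is encoded on 'I_M, the value at age x
   being stored at index x - 1. *)
Definition cost_family (R : realType) (N M : nat) : Type := 'I_N -> 'I_M -> R.

(* Value at age x. The value 0 given to ages beyond M is a dummy: such ages do
   not occur within an epoch, and a decision affects the costs only in the
   slots j <= M - 1, where x + 1 <= M for every age x. *)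
Definition at_age (R : realType) (M : nat) (h : 'I_M -> R) (x : nat) : R :=
  if insub x.-1 is Some y then h y else 0.

Definition nondecreasing_family (R : realType) (N M : nat)
    (f : cost_family R N M) : Prop :=
  forall (i : 'I_N) (x y : 'I_M), (x <= y)%N -> f i x <= f i y.

Definition bounded_family (R : realType) (N M : nat) (D : R)
    (f : cost_family R N M) : Prop :=
  forall (i : 'I_N) (x : 'I_M), 0 <= f i x <= D.

Definition epoch_cost (R : realType) (N M : nat) (g : cost_family R N M)
    (pi : policy N) : R :=
  (N * M)%:R^-1 *
  \sum_(1 <= j < M.+1) \sum_(i < N) at_age (g i) (sval (aoi pi j i)).

Definition min_cost (R : realType) (N M : nat) (g : cost_family R N M) : R :=
  inf (range (epoch_cost g)).

Definition max_cost_gap (R : realType) (N M : nat)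
    (f g : cost_family R N M) : R :=
  sup (range (fun pi => `|epoch_cost f pi - epoch_cost g pi|)).

(* The two extrema above are attained, i.e. they are a minimum and a maximum:
   the cost depends on the policy only through its M decisions. *)
Section Attained.
Variables (R : realType) (N M : nat).

Let decisions (pi : policy N) : {ffun 'I_M -> 'I_N} :=
  [ffun j : 'I_M => pi (aoi pi j.+1)].

Let aoi_decisions (pi pi' : policy N) :
  decisions pi = decisions pi' ->
  forall j, (j <= M)%N -> aoi pi j = aoi pi' j.
Proof.
move=> e; case=> [|j] //; elim: j => [|j IHj] // jM.
have := IHj (ltnW jM); rewrite /aoi /= => E.
move/ffunP: e => /(_ (Ordinal (ltnW jM))); rewrite !ffunE /aoi /= => e.
by rewrite -E in e *; rewrite /aoi_step e.
Qed.

Let epoch_cost_decisions (g : cost_family R N M) (pi pi' : policy N) :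
  decisions pi = decisions pi' -> epoch_cost g pi = epoch_cost g pi'.
Proof.
move=> e; rewrite /epoch_cost; congr (_ * _).
by apply: eq_big_nat => j /andP[_ jM]; rewrite (aoi_decisions e).
Qed.

Let ex_max (F : policy N -> R) : (0 < N)%N ->
  (forall pi pi', decisions pi = decisions pi' -> F pi = F pi') ->
  exists pi, forall pi', F pi' <= F pi.
Proof.
move=> N0 FE; pose p0 : policy N := fun=> Ordinal N0.
have [rep repE] : {rep : {ffun 'I_M -> 'I_N} -> policy N |
    forall pi, decisions (rep (decisions pi)) = decisions pi}.
  exists (fun s => xget p0 [set pi | decisions pi = s]) => pi.
  by apply: (@xgetPex _ p0 [set q | decisions q = decisions pi]); exists pi.
case: (@arg_maxP _ _ _ (decisions p0) xpredT (F \o rep)) => // s _ sP.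
by exists (rep s) => pi; rewrite -(FE _ _ (repE pi)); exact: sP.
Qed.

Lemma min_cost_attained (g : cost_family R N M) : (0 < N)%N ->
  exists pi, min_cost g = epoch_cost g pi /\
    forall pi', epoch_cost g pi <= epoch_cost g pi'.
Proof.
move=> N0; have [|pi piP] := @ex_max (fun pi => - epoch_cost g pi) N0.
  by move=> pi pi' /(epoch_cost_decisions g) ->.
have {}piP pi' : epoch_cost g pi <= epoch_cost g pi' by rewrite -lerN2.
exists pi; split=> //; apply/eqP; rewrite eq_le; apply/andP; split.
  by apply: ge_inf; [exists (epoch_cost g pi) => _ [pi' _ <-] | exists pi].
by apply: lb_le_inf; [exists (epoch_cost g pi), pi | move=> _ [pi' _ <-]].
Qed.

Lemma max_cost_gap_attained (f g : cost_family R N M) : (0 < N)%N ->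
  exists pi, max_cost_gap f g = `|epoch_cost f pi - epoch_cost g pi| /\
    forall pi', `|epoch_cost f pi' - epoch_cost g pi'| <=
                `|epoch_cost f pi - epoch_cost g pi|.
Proof.
move=> N0.
have [|pi piP] := @ex_max (fun pi => `|epoch_cost f pi - epoch_cost g pi|) N0.
  move=> pi pi' e.
  by rewrite (epoch_cost_decisions f e) (epoch_cost_decisions g e).
exists pi; split=> //; apply/eqP; rewrite eq_le; apply/andP; split.
  by apply: ge_sup; [eexists; exists pi | move=> _ [pi' _ <-]; exact: piP].
by apply: ub_le_sup; [eexists => _ [pi' _ <-]; exact: piP | exists pi].
Qed.

End Attained.

Definition whittle_index (R : realType) (M : nat) (h : 'I_M -> R) (x : nat)
    : R :=
  x%:R * at_age h x.+1 - \sum_(1 <= m < x.+1) at_age h m.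

(* Sources are compared by decreasing index, ties being resolved in favour of
   the tie-smaller source; when tie is a total order, so is this relation. *)
Definition whittle_before (R : realType) (N M : nat) (tie : rel 'I_N)
    (f : cost_family R N M) (A : 'I_N -> age) : rel 'I_N := fun i j =>
  let W := fun l => whittle_index (f l) (sval (A l)) in
  (W j < W i) || (W j == W i) && tie i j.

Definition whittle (R : realType) (N M : nat) (N_gt0 : (0 < N)%N)
    (tie : rel 'I_N) (f : cost_family R N M) : policy N := fun A =>
  extremum (whittle_before tie f A) (Ordinal N_gt0) xpredT id.

Definition total_order_rel (N : nat) (tie : rel 'I_N) : Prop :=
  [/\ reflexive tie, antisymmetric tie, transitive tie & total tie].

Lemma whittle_first (R : realType) (N M : nat) (N_gt0 : (0 < N)%N)
    (tie : rel 'I_N) (f : cost_family R N M) (A : 'I_N -> age) (i : 'I_N) :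
  total_order_rel tie -> whittle_before tie f A (whittle N_gt0 tie f A) i.
Proof.
move=> [tie_refl _ tie_trans tie_total]; rewrite /whittle.
case: extremumP => [j|k j l|j k|//|j _ jP]; last exact: jP.
- by rewrite /whittle_before eqxx tie_refl orbT.
- rewrite /whittle_before; case: ltgtP => //= [kj _|kj jk].
    by case: ltgtP => //= [lk _|lk _]; [rewrite (lt_trans lk kj)
                                       |rewrite lk kj].
  rewrite kj; case: ltgtP => //= _; exact: tie_trans.
- by rewrite /whittle_before; case: ltgtP => //= _; exact: tie_total.
Qed.

Definition opt_selection (R : realType) (N M : nat)
    (opt : cost_family R N M -> policy N) : Prop :=
  forall f : cost_family R N M, nondecreasing_family f ->
  forall pi : policy N, epoch_cost f (opt f) <= epoch_cost f pi.

Definition whittle_close (R : realType) (N M : nat) (N_gt0 : (0 < N)%N)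
    (tie : rel 'I_N) (opt : cost_family R N M -> policy N) (D alpha : R)
    : Prop :=
  forall f g : cost_family R N M,
    nondecreasing_family f -> bounded_family D f ->
    nondecreasing_family g -> bounded_family D g ->
    `|epoch_cost g (whittle N_gt0 tie f) - epoch_cost g (opt f)| <= alpha.

(* Sequences of cost families are indexed by nat; only the entries 1, ..., T are
   used. *)
Definition admissible (R : realType) (N M T : nat) (D V : R)
    : set (nat -> cost_family R N M) :=
  [set f | (forall k, (1 <= k <= T)%N ->
              nondecreasing_family (f k) /\ bounded_family D (f k)) /\
           \sum_(2 <= k < T.+1) max_cost_gap (f k.-1) (f k) <= V].
Arguments admissible R N M T D V : clear implicits.

Definition init_family (R : realType) (N M : nat) : cost_family R N M :=
  fun _ x => x.+1%:R.
Arguments init_family R N M : clear implicits.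

Definition fdwl (R : realType) (N M : nat) (N_gt0 : (0 < N)%N)
    (tie : rel 'I_N) (f : nat -> cost_family R N M) (k : nat) : policy N :=
  whittle N_gt0 tie (if (k <= 1)%N then init_family R N M else f k.-1).

Definition dynamic_regret (R : realType) (N M T : nat)
    (f : nat -> cost_family R N M) (pi : nat -> policy N) : R :=
  \sum_(1 <= k < T.+1) epoch_cost (f k) (pi k) -
  \sum_(1 <= k < T.+1) min_cost (f k).

(* Main.v *)
Require Import Defs.
From mathcomp Require Import all_boot all_order all_algebra.
From mathcomp Require Import all_classical all_reals ereal.
From mathcomp Require Import lra.

Import Order.TTheory GRing.Theory Num.Theory.

Local Open Scope classical_set_scope.
Local Open Scope ring_scope.

(** Write [v_k] for the variation between epochs [k-1] and [k].  For [k >= 2],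
    closeness replaces [Whittle(f_{k-1})] by [Opt(f_{k-1})], so that
    [C_k(pi_k) <= C_k(Opt(f_{k-1})) + alpha <= min C_{k-1} + v_k + alpha].
    Comparing with [min C_{k-1}] rather than with [min C_k] spends [v_k] only
    once; the minima then telescope, leaving [C_1(pi_1) - min C_T <= D]. *)

(** Beyond age [M] the value is the dummy 0, which lies in the range because [0 <= D]. *)
Lemma at_age_bounded (R : realType) (N M : nat) (D : R)
    (f : cost_family R N M) (i : 'I_N) (x : nat) :
  0 <= D -> bounded_family D f -> 0 <= at_age (f i) x <= D.
Proof.
move=> D_ge0 fD; rewrite /at_age.
by case: insubP => [y _ _|_]; [exact: fD | rewrite lexx].
Qed.

Lemma epoch_cost_ge0 (R : realType) (N M : nat) (D : R)
    (f : cost_family R N M) (pi : policy N) :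
  0 <= D -> bounded_family D f -> 0 <= epoch_cost f pi.
Proof.
move=> D_ge0 fD; rewrite mulr_ge0 ?invr_ge0 ?ler0n //.
apply: sumr_ge0 => j _; apply: sumr_ge0 => i _.
by have /andP[] := at_age_bounded _ _ _ _ f i (sval (aoi pi j i)) D_ge0 fD.
Qed.

Lemma epoch_cost_le (R : realType) (N M : nat) (D : R)
    (f : cost_family R N M) (pi : policy N) :
  0 <= D -> bounded_family D f -> epoch_cost f pi <= D.
Proof.
move=> D_ge0 fD; rewrite /epoch_cost.
(* In the degenerate case the convention [0^-1 = 0] makes the cost 0. *)
have [->|NM_neq0] := eqVneq (N * M)%N 0%N; first by rewrite invr0 mul0r.
rewrite ler_pdivrMl ?ltr0n ?lt0n //.
have -> : (N * M)%:R * D = \sum_(1 <= j < M.+1) \sum_(i < N) D.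
  by rewrite sumr_const_nat sumr_const card_ord subn1 -mulrnA mulr_natl.
apply: ler_sum => j _; apply: ler_sum => i _.
by have /andP[] := at_age_bounded _ _ _ _ f i (sval (aoi pi j i)) D_ge0 fD.
Qed.

Lemma epoch_cost_le_gap (R : realType) (N M : nat) (f g : cost_family R N M)
    (pi : policy N) : (0 < N)%N ->
  epoch_cost g pi <= epoch_cost f pi + max_cost_gap f g.
Proof.
move=> N_gt0; have [q [-> /(_ pi)]] := max_cost_gap_attained f g N_gt0.
by rewrite distrC => /(le_trans (ler_norm _)); rewrite lerBlDl.
Qed.

Lemma min_cost_opt (R : realType) (N M : nat)
    (opt : cost_family R N M -> policy N) (f : cost_family R N M) :
  (0 < N)%N -> opt_selection opt -> nondecreasing_family f ->
  epoch_cost f (opt f) <= min_cost f.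
Proof.
by move=> N_gt0 opt_min f_nd; have [q [-> _]] := min_cost_attained f N_gt0;
  exact: opt_min.
Qed.

Lemma whittle_cost_le (R : realType) (N M : nat) (N_gt0 : (0 < N)%N)
    (D alpha : R) (tie : rel 'I_N) (opt : cost_family R N M -> policy N)
    (f g : cost_family R N M) :
  opt_selection opt -> whittle_close N_gt0 tie opt D alpha ->
  nondecreasing_family f -> bounded_family D f ->
  nondecreasing_family g -> bounded_family D g ->
  epoch_cost g (whittle N_gt0 tie f) <= alpha + min_cost f + max_cost_gap f g.
Proof.
move=> opt_min close f_nd fD g_nd gD.
have := le_trans (ler_norm _) (close f g f_nd fD g_nd gD).
have := epoch_cost_le_gap _ _ _ f g (opt f) N_gt0.
have := min_cost_opt _ _ _ _ _ N_gt0 opt_min f_nd.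
by lra.
Qed.

(** The costs of epochs 1 to [n.+1] face the minima of epochs 1 to [n] only: each later epoch is
    charged to its predecessor's minimum. Closeness need not apply to epoch 1, since [init_family]
    may exceed [D]; its cost is bounded by [D] directly, so [alpha] is paid just [n] times. *)
Lemma fdwl_cost_le (R : realType) (N M T : nat) (N_gt0 : (0 < N)%N)
    (D alpha : R) (tie : rel 'I_N) (opt : cost_family R N M -> policy N)
    (f : nat -> cost_family R N M) (n : nat) :
  0 <= D -> opt_selection opt -> whittle_close N_gt0 tie opt D alpha ->
  (forall k, (1 <= k <= T)%N ->
     nondecreasing_family (f k) /\ bounded_family D (f k)) ->
  (n < T)%N ->
  \sum_(1 <= k < n.+2) epoch_cost (f k) (fdwl N_gt0 tie f k) <=
  \sum_(1 <= k < n.+1) min_cost (f k) +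
  alpha * n%:R + \sum_(2 <= k < n.+2) max_cost_gap (f k.-1) (f k) + D.
Proof.
move=> D_ge0 opt_min close fP; elim: n => [T_gt0|n IHn nT].
  rewrite big_nat1 !big_geq // mulr0 !add0r.
  by apply: (epoch_cost_le _ _ _ D) => //; case: (fP 1%N).
rewrite [leLHS]big_nat_recr //= [X in _ <= X + _ + _ + _]big_nat_recr //=.
rewrite [X in _ <= _ + X + _]big_nat_recr //= -natr1.
have [f1_nd f1D] := fP n.+1 (ltnW nT).
have [f2_nd f2D] := fP n.+2 nT.
have := whittle_cost_le _ _ _ _ _ _ _ _ _ _ opt_min close f1_nd f1D f2_nd f2D.
(* The third occurrence is the policy of epoch [n.+2], which becomes the Whittle policy of
   [f n.+1]. *)
by have := IHn (ltnW nT); rewrite {3}/fdwl /=; lra.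
Qed.

Theorem lemma5 (R : realType) (N M T : nat)
    (N_gt0 : (0 < N)%N) (M_gt0 : (0 < M)%N) (T_gt0 : (0 < T)%N)
    (D V alpha : R) (D_gt0 : 0 < D) (V_ge0 : 0 <= V) (alpha_ge0 : 0 <= alpha)
    (tie : rel 'I_N) (tie_order : total_order_rel tie)
    (opt : cost_family R N M -> policy N) (opt_min : opt_selection opt)
    (close : whittle_close N_gt0 tie opt D alpha) :
  (ereal_sup [set (dynamic_regret T f (fdwl N_gt0 tie f))%:E
             | f in admissible R N M T D V]
   <= (alpha * T%:R + V + D)%:E)%E.
Proof.
apply: ge_ereal_sup => _ [f [fP fV] <-]; rewrite lee_fin /dynamic_regret.
case: T T_gt0 fP fV => // n _ fP fV.
have regret_le := fdwl_cost_le _ _ _ _ _ _ _ _ _ _ _ (ltW D_gt0) opt_min close fP (ltnSn n).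
have min_ge0 : 0 <= min_cost (f n.+1).
  have [q [-> _]] := min_cost_attained (f n.+1) N_gt0.
  apply: (epoch_cost_ge0 _ _ _ D _ _ (ltW D_gt0)).
  by case: (fP n.+1 (leqnn _)).
rewrite [X in _ - X]big_nat_recr //= -natr1.
by move: regret_le; lra.
Qed.
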